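(* For every real number $c$, every integer $n\ge3$ and every positive integer $k$, $$\sum_{m=1}^kT_m\left(\frac1{2\sqrt{n-2}}\right)I_m^c(k)=\frac12\left(1+\frac{c}{2\sqrt{n-2}}\right)^k-\frac12I_0^c(k).$$
   Context: $T_m$ is the Chebyshev polynomial of the first kind. Discrete $I$-Bessel function: for $t,n\in\mathbb{N}_0$ with $n\le t$ and $c\in\mathbb{C}$, $$I_n^c(t)=\sum_{\ell=0}^{\lfloor (t-n)/2\rfloor}\frac{t!}{\ell!\,(t-2\ell-n)!\,(n+\ell)!}\left(\frac c2\right)^{2\ell+n},$$ and $I_n^c(t)=0$ for $n>t$ (with $0^0=1$). *)

(* Defs.v *)
From HB Require Import structures.
From mathcomp Require Import all_boot all_order all_algebra.
From mathcomp Require Import reals.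
Set Implicit Arguments.
Unset Strict Implicit.
Unset Printing Implicit Defensive.
Import Order.TTheory GRing.Theory Num.Theory.
Local Open Scope ring_scope.

(* Chebyshev polynomials of the first kind:
   T_0 = 1, T_1 = X, T_(m+2) = 2 X T_(m+1) - T_m. *)
Fixpoint chebyshevT (R : comNzRingType) (m : nat) : {poly R} :=
  match m with
  | 0 => 1
  | 1 => 'X
  | (m''.+1 as m').+1 => 2%:R * 'X * chebyshevT R m' - chebyshevT R m''
  end.

(* Discrete I-Bessel function I_n^c(t). A numFieldType covers both real and
   complex c. For n <= t and l <= (t - n)./2 the truncated subtractions are
   exact; x ^+ 0 = 1 also for x = 0. *)
Definition discreteBesselI (K : numFieldType) (c : K) (n t : nat) : K :=
  if (n <= t)%N then
    \sum_(0 <= l < ((t - n)./2).+1)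
      (t`!)%:R / ((l`!)%:R * ((t - 2 * l - n)`!)%:R * ((n + l)`!)%:R)
        * (c / 2%:R) ^+ (2 * l + n)
  else 0.

(* Main.v *)
Require Import Defs.
From mathcomp Require Import all_boot all_order all_algebra.
From mathcomp Require Import reals.
From mathcomp Require Import ring zify.
Import Order.TTheory GRing.Theory Num.Theory.
Local Open Scope ring_scope.

(** The identity is an instance, at [x = 1 / (2 sqrt (n - 2))], of
<<
      I_0(t) + 2 * sum_(m >= 1) T_m(x) I_m(t) = (1 + c x) ^ t,
>>
    which holds for every [x].  With [x = (z + 1/z) / 2] one has
    [T_m(x) = (z^m + z^-m) / 2], and the left-hand side is the Laurent
    expansion of [(1 + (c/2) (z + 1/z)) ^ t]: [I_m(t)] is its coefficient
    of [z^m] and of [z^-m].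

    The proof avoids Laurent polynomials.  Multiplying by
    [1 + (c/2) (z + 1/z)] becomes the recurrence [I_m(t+1) = I_m(t) +
    (c/2) (I_(m-1)(t) + I_(m+1)(t))] ([centralCoefS], and [centralCoef0S] for
    the reflected boundary case [m = 0]), which follows from two uses of
    Pascal's rule once the factorial quotient is written as a product of two
    binomial coefficients.  Multiplication by [2 x] acts on Chebyshev
    polynomials by [2 x T_(m+1) = T_(m+2) + T_m].  Both are the same
    symmetric second-order difference operator; summation by parts
    ([sum_neighboursE]) moves it from one factor to the other, so that
    increasing [t] by one multiplies the sum by [1 + c x]
    ([chebyshev_expansion]). *)

Section CentralCoefficients.
Context {A : comNzRingType}.
Implicit Types (x y : A) (m t l N : nat).

Definition centralTerm y m t l : A :=
  ('C(t, 2 * l + m) * 'C(2 * l + m, l))%:R * y ^+ (2 * l + m).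

(** The coefficient of [z^m] in [(1 + y z + y / z) ^ t]: choose the
    [2 l + m] factors that do not contribute 1, and among them the [l] that
    contribute [y / z]. *)
Definition centralCoef y m t : A := \sum_(0 <= l < t.+1) centralTerm y m t l.

Lemma centralTerm_small y m t l : (t < 2 * l + m)%N -> centralTerm y m t l = 0.
Proof. by move=> h; rewrite /centralTerm bin_small // mul0n mul0r. Qed.

Lemma centralCoef_small y m t : (t < m)%N -> centralCoef y m t = 0.
Proof.
by move=> h; rewrite /centralCoef big1 // => l _; apply: centralTerm_small; lia.
Qed.

(** Only the terms with [2 l + m <= t] are nonzero; this connects the uniform
    range in [centralCoef] with the tight range of the Bessel sum. *)
Lemma centralCoef_bound N y m t : (t < 2 * N + m)%N -> (N <= t.+1)%N ->
  centralCoef y m t = \sum_(0 <= l < N) centralTerm y m t l.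
Proof.
move=> h hN; rewrite /centralCoef (big_cat_nat (leq0n N) hN) /=.
rewrite [X in _ + X]big_nat_cond [X in _ + X]big1 ?addr0 // => l hl.
by apply: centralTerm_small; lia.
Qed.

Lemma centralCoefSr y m t :
  \sum_(0 <= l < t.+2) centralTerm y m t l = centralCoef y m t.
Proof. by rewrite big_nat_recr //= centralTerm_small ?addr0 //; lia. Qed.

(** Condition on the last of the [t + 1] factors (Pascal's rule in the upper
    binomial), and on whether it contributes [y z] or [y / z] (Pascal's rule
    in the lower one). *)
Lemma centralCoefS y m t :
  centralCoef y m.+1 t.+1
  = centralCoef y m.+1 t + y * (centralCoef y m t + centralCoef y m.+2 t).
Proof.
rewrite -(centralCoefSr y m.+1 t) -(centralCoefSr y m t).
rewrite mulrDr addrA /centralCoef !mulr_sumr -big_split /=.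
rewrite big_nat_recl // [X in _ = X + _]big_nat_recl // -[RHS]addrA -big_split /=.
congr (_ + _).
  rewrite /centralTerm muln0 !add0n !bin0 !muln1 binS natrD exprS; ring.
apply: eq_bigr => l _; rewrite /centralTerm /=.
have -> : (2 * l.+1 + m.+1 = (2 * l + m.+2).+1)%N by lia.
have -> : (2 * l.+1 + m = 2 * l + m.+2)%N by lia.
by rewrite !binS exprS !natrM !natrD; ring.
Qed.

(** At [m = 0] the neighbours [z] and [1 / z] have equal coefficients, whence
    the factor 2. *)
Lemma centralCoef0S y t :
  centralCoef y 0 t.+1 = centralCoef y 0 t + 2%:R * y * centralCoef y 1 t.
Proof.
rewrite -(centralCoefSr y 0 t) /centralCoef mulr_sumr.
rewrite big_nat_recl // [X in _ = X + _]big_nat_recl // -[RHS]addrA -big_split /=.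
congr (_ + _).
  by rewrite /centralTerm muln0 !bin0.
apply: eq_bigr => l _; rewrite /centralTerm /=.
have -> : (2 * l.+1 + 0 = (2 * l + 1).+1)%N by lia.
have bin_sym : 'C(2 * l + 1, l.+1) = 'C(2 * l + 1, l).
  by rewrite -[LHS]bin_sub; [congr 'C(_, _); lia | lia].
by rewrite !binS bin_sym exprS !natrM !natrD; ring.
Qed.

(** Summation by parts for the operator [u |-> (m |-> u m + u m.+2)]; the last
    two terms are the boundary contributions. *)
Lemma sum_neighboursE (u b : nat -> A) N :
  u 0 * b 1 + \sum_(0 <= m < N) u m.+1 * (b m + b m.+2)
  = u 1 * b 0 + \sum_(0 <= m < N) (u m.+2 + u m) * b m.+1
    - u N.+1 * b N + u N * b N.+1.
Proof.
elim: N => [|N IH]; first by rewrite !big_nil; ring.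
by rewrite !big_nat_recr //= addrA IH; ring.
Qed.

Lemma hornerT0 x : (chebyshevT A 0).[x] = 1.
Proof. exact: hornerC. Qed.

Lemma hornerT1 x : (chebyshevT A 1).[x] = x.
Proof. exact: hornerX. Qed.

Lemma hornerTSS x m :
  (chebyshevT A m.+2).[x] + (chebyshevT A m).[x]
  = 2%:R * x * (chebyshevT A m.+1).[x].
Proof.
have -> : chebyshevT A m.+2 = 2%:R * 'X * chebyshevT A m.+1 - chebyshevT A m by [].
rewrite hornerD hornerN subrK.
by rewrite !hornerM hornerX -[2%:R]polyC_natr hornerC.
Qed.

(** The upper bound [N] is left free because the induction on [t] compares sums
    over the same range; all terms with index above [t] vanish. *)
Lemma chebyshev_expansion x y t N : (t <= N)%N ->
  centralCoef y 0 t
  + 2%:R * \sum_(0 <= m < N) (chebyshevT A m.+1).[x] * centralCoef y m.+1 t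
  = (1 + 2%:R * y * x) ^+ t.
Proof.
elim: t => [|t IH] hN.
  rewrite [X in _ * X]big1 => [|m _]; last by rewrite centralCoef_small ?mulr0.
  by rewrite /centralCoef big_nat1 /centralTerm expr0 !muln0 !mulr1 mulr0 addr0.
rewrite exprS -IH ?(ltnW hN) //.
pose u m := (chebyshevT A m).[x]; pose b m := centralCoef y m t.
pose S := \sum_(0 <= m < N) u m.+1 * b m.+1.
pose D := \sum_(0 <= m < N) u m.+1 * (b m + b m.+2).
have stepE : \sum_(0 <= m < N) u m.+1 * centralCoef y m.+1 t.+1 = S + y * D.
  rewrite mulr_sumr -big_split; apply: eq_bigr => m _ /=.
  by rewrite centralCoefS /b; ring.
have parts : b 1%N + D = x * b 0%N + 2%:R * x * S.
  have := sum_neighboursE u b N.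
  (* Both boundary terms vanish because t < N. *)
  rewrite [b N]centralCoef_small // [b N.+1]centralCoef_small ?leqW //.
  rewrite !mulr0 subr0 addr0 /u hornerT0 hornerT1 mul1r => ->.
  congr (_ + _); rewrite mulr_sumr; apply: eq_bigr => m _.
  by rewrite hornerTSS mulrA.
rewrite stepE centralCoef0S -/(b 0%N) -/(b 1%N) -/S.
transitivity (b 0%N + 2%:R * S + 2%:R * y * (b 1%N + D)); first by ring.
by rewrite parts; ring.
Qed.

End CentralCoefficients.

Lemma discreteBesselIE (K : numFieldType) (c : K) (m t : nat) :
  discreteBesselI c m t = centralCoef (c / 2%:R) m t.
Proof.
rewrite /discreteBesselI; case: leqP => [mt|tm]; last by rewrite centralCoef_small.
rewrite (centralCoef_bound ((t - m)./2.+1)); try lia.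
apply: eq_big_nat => l hl; rewrite /centralTerm; congr (_ * _).
have factE : (t`! = 'C(t, 2 * l + m) * 'C(2 * l + m, l)
                    * (l`! * (t - 2 * l - m)`! * (m + l)`!))%N.
  rewrite -(@bin_fact t (2 * l + m)); last by lia.
  rewrite -(@bin_fact (2 * l + m) l); last by lia.
  have -> : (2 * l + m - l = m + l)%N by lia.
  by rewrite subnDA; ring.
by rewrite -!natrM factE natrM mulfK // pnatr_eq0 -lt0n !muln_gt0 !fact_gt0.
Qed.

Theorem mainTheorem4 (R : realType) (c : R) (n k : nat)
    (hn : (3 <= n)%N) (hk : (0 < k)%N) :
  \sum_(1 <= m < k.+1)
      (chebyshevT R m).[1 / (2%:R * Num.sqrt (n%:R - 2%:R))]
        * discreteBesselI c m k
  = 1 / 2%:R * (1 + c / (2%:R * Num.sqrt (n%:R - 2%:R))) ^+ k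
    - 1 / 2%:R * discreteBesselI c 0 k.
Proof.
set s := 2%:R * Num.sqrt _.
have two_neq0 : 2%:R != 0 :> R by rewrite pnatr_eq0.
have -> : c / s = 2%:R * (c / 2%:R) * (1 / s).
  by rewrite mul1r [2%:R * _]mulrC divfK.
rewrite -(chebyshev_expansion (1 / s) (c / 2%:R) _ _ (leqnn k)) discreteBesselIE.
rewrite big_add1 /=.
under eq_bigr do rewrite discreteBesselIE.
by rewrite mulrDr addrAC subrr add0r !mul1r mulKf.
Qed.
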